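(* Let $(\mathfrak g,[\cdot,\cdot]_{\mathfrak g})$ be a Leibniz algebra and $r\in\mathrm{Sym}^2(\mathfrak g)$ a solution of the classical Leibniz Yang–Baxter equation $[[r,r]]=0$ in $\mathfrak g$. Let $r^\sharp:\mathfrak g^*\to\mathfrak g$ be defined by $\langle r^\sharp(\xi),\eta\rangle=\langle r,\xi\otimes\eta\rangle$ for all $\xi,\eta\in\mathfrak g^*$. Then $(\mathfrak g,\mathfrak g^*_{r^\sharp})$ is a Leibniz bialgebra, where $\mathfrak g^*_{r^\sharp}$ is $\mathfrak g^*$ with the Leibniz bracket $[\xi,\eta]_{r^\sharp}=L^*_{r^\sharp\xi}\eta-L^*_{r^\sharp\eta}\xi-R^*_{r^\sharp\eta}\xi$.
   Context: All vector spaces are finite-dimensional over an algebraically closed field $\mathbb K$ of characteristic $0$. A Leibniz algebra is a vector space with a bilinear operation satisfying $[x,[y,z]]=[[x,y],z]+[y,[x,z]]$. Put $L_xy=[x,y]_{\mathfrak g}$, $R_xy=[y,x]_{\mathfrak g}$; $L^*,R^*:\mathfrak g\to\mathfrak{gl}(\mathfrak g^* )$ are defined by $\langle L_x^*\xi,y\rangle=-\langle\xi,[x,y]_{\mathfrak g}\rangle$, $\langle R_x^*\xi,y\rangle=-\langle\xi,[y,x]_{\mathfrak g}\rangle$. The bracket $[[\cdot,\cdot]]:\otimes^2\mathfrak g\times\otimes^2\mathfrak g\to\otimes^3\mathfrak g$ is the bilinear map determined as follows. For $P\in\mathfrak g\otimes\mathfrak g$ let $\Psi(P):\mathfrak g^*\to\mathfrak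 g$, $\langle\Psi(P)\xi,\eta\rangle=\langle P,\xi\otimes\eta\rangle$. With $f=\Psi(P)$, $g=\Psi(Q)$, $\langle[[P,Q]],\xi_1\otimes\xi_2\otimes\xi_3\rangle=\langle\{f,g\}(\xi_1,\xi_2),\xi_3\rangle$, where $$\{f,g\}(\xi_1,\xi_2)=-f(L^*_{g\xi_1}\xi_2)+f(L^*_{g\xi_2}\xi_1)+f(R^*_{g\xi_2}\xi_1)+[g\xi_1,f\xi_2]_{\mathfrak g}+[f\xi_1,g\xi_2]_{\mathfrak g}-g(L^*_{f\xi_1}\xi_2)+g(L^*_{f\xi_2}\xi_1)+g(R^*_{f\xi_2}\xi_1).$$ Leibniz bialgebra: given Leibniz algebra structures on $\mathfrak g$ and $\mathfrak g^*$, let $\triangle:\mathfrak g\to\mathfrak g\otimes\mathfrak g$ be given by $\langle\triangle x,\xi\otimes\eta\rangle=\langle x,[\xi,\eta]_{\mathfrak g^*}\rangle$ and $\tau_{12}(x\otimes y)=y\otimes x$. The pair $(\mathfrak g,\mathfrak g^* )$ is a Leibniz bialgebra if for all $x,y\in\mathfrak g$: (a) $\tau_{12}\big((R_y\otimes\mathrm{Id})(\triangle x)\big)=(R_x\otimes\mathrm{Id})(\triangle y)$; (b) $\triangle[x,y]_{\mathfrak g}=\big((\mathrm{Id}\otimes R_y-L_y\otimes\mathrm{Id}-R_y\otimes\mathrm{Id})\circ(\mathrm{Id}+\tau_{12})\big)\triangle x+(\mathrm{Id}\otimes L_x+L_x\otimes\mathrm{Id})\triangle y$. *)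

(* Defs.v *)
From mathcomp Require Import all_boot all_order all_algebra.
From HB Require Import structures.

Set Implicit Arguments.
Unset Strict Implicit.
Unset Printing Implicit Defensive.

Import GRing.Theory VectorInternalTheory.
Local Open Scope ring_scope.

Notation "''Dual' ( V )" := ('Hom(V, _^o)) (at level 0, V at level 200) : type_scope.

Lemma linfunE (K : fieldType) (U V : vectType K) (f : U -> V) :
  linear f -> linfun f =1 f.
Proof.
move=> lf; exact: (lfunE (HB.pack f (GRing.isLinear.Build K U V _ f lf)
  : {linear U -> V})).
Qed.

Lemma linear_comb (K : fieldType) (U W : lmodType K) (f : U -> W) (I : finType)
    (c : I -> K) (v : I -> U) :
  linear f -> f (\sum_i c i *: v i) = \sum_i c i *: f (v i).
Proof.
move=> lf; pose h : {linear U -> W} :=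
  HB.pack f (GRing.isLinear.Build K U W _ f lf).
by rewrite -[f]/(h : U -> W) linear_sum; apply: eq_bigr => i _; rewrite linearZ.
Qed.

(* bvec is the coordinate basis provided by the vectType structure, bcov the
   dual basis *)
Section Basis.
Variables (K : fieldType) (V : vectType K).
Implicit Types (v : V) (xi : 'Dual(V)).

Definition bvec (i : 'I_(dim V)) : V := r2v (delta_mx 0 i).

Definition bcoord (i : 'I_(dim V)) (v : V) : K^o := v2r v 0 i.

Fact bcoord_linear i : linear (bcoord i).
Proof. by move=> a u v; rewrite /bcoord linearP !mxE. Qed.
HB.instance Definition _ i :=
  GRing.isLinear.Build K V K^o _ (bcoord i) (bcoord_linear i).

Definition bcov (i : 'I_(dim V)) : 'Dual(V) := linfun (bcoord i).

Lemma bcovE i v : bcov i v = v2r v 0 i.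
Proof. by rewrite lfunE. Qed.

Lemma bcov_bvec i j : bcov i (bvec j) = (i == j)%:R.
Proof. by rewrite bcovE r2vK mxE eqxx. Qed.

Lemma vec_exp v : v = \sum_i bcov i v *: bvec i.
Proof.
apply: (can_inj v2rK); rewrite linear_sum; apply/rowP => j.
rewrite summxE (bigD1 j) //= big1 ?addr0 => [|i ij].
  by rewrite linearZ /= r2vK bcovE !mxE !eqxx mulr1.
by rewrite linearZ /= r2vK !mxE eqxx eq_sym (negPf ij) mulr0.
Qed.

Lemma cov_exp xi : xi = \sum_i xi (bvec i) *: bcov i.
Proof.
apply/lfunP => v; rewrite {1}(vec_exp v) linear_sum sum_lfunE /=.
by apply: eq_bigr => i _; rewrite linearZ scale_lfunE /= [LHS]mulrC.
Qed.

Lemma dual_inj v w : (forall xi : 'Dual(V), xi v = xi w) -> v = w.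
Proof.
move=> vw; rewrite (vec_exp v) (vec_exp w).
by apply: eq_bigr => i _; rewrite vw.
Qed.
End Basis.

(* A model of the tensor product: P is the matrix of coefficients of the
   bvec i (x) bvec j; tens_lift, tens_lift_pure and tens_exp give its
   universal property. *)
Definition tens (K : fieldType) (U V : vectType K) := 'M[K]_(dim U, dim V).
HB.instance Definition _ (K : fieldType) (U V : vectType K) :=
  Vector.copy (tens U V) 'M[K]_(dim U, dim V).

Notation "U \ot V" := (tens U V) (at level 40, left associativity) : type_scope.

Section Tensor.
Variables (K : fieldType) (U V : vectType K).

Definition pure (u : U) (v : V) : U \ot V := (v2r u)^T *m v2r v.

Definition tens_lift (W : lmodType K) (b : U -> V -> W) (P : U \ot V) : W :=
  \sum_i \sum_j P i j *: b (bvec i) (bvec j).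

Lemma pureE u v i j : pure u v i j = bcov i u * bcov j v.
Proof. by rewrite !bcovE mxE big_ord1 mxE. Qed.

Fact tens_lift_linear (W : lmodType K) (b : U -> V -> W) : linear (@tens_lift W b).
Proof.
move=> a P Q; rewrite /tens_lift scaler_sumr -big_split; apply: eq_bigr => i _.
rewrite scaler_sumr -big_split; apply: eq_bigr => j _ /=.
by rewrite !mxE scalerDl scalerA.
Qed.
HB.instance Definition _ (W : lmodType K) (b : U -> V -> W) :=
  GRing.isLinear.Build K (U \ot V) W _ (@tens_lift W b) (@tens_lift_linear W b).

Lemma tens_lift_pure (W : lmodType K) (b : U -> V -> W) u v :
  bilinear_for *:%R *:%R b -> tens_lift b (pure u v) = b u v.
Proof.
case=> bl br; rewrite {2}(vec_exp u) (linear_comb _ _ (bl v)).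
apply: eq_bigr => i _; rewrite {2}(vec_exp v) (linear_comb _ _ (br _)) scaler_sumr.
by apply: eq_bigr => j _; rewrite scalerA -pureE.
Qed.

Lemma tens_exp (P : U \ot V) : P = \sum_i \sum_j P i j *: pure (bvec i) (bvec j).
Proof.
apply/matrixP => k l; rewrite summxE (bigD1 k) //= summxE (bigD1 l) //=.
rewrite !big1 => [|i ik|j jl]; rewrite ?summxE; try (apply: big1 => j _).
all: rewrite mxE pureE !bcov_bvec.
- by rewrite !eqxx !mulr1 !addr0.
- by rewrite eq_sym (negPf ik) mul0r mulr0.
- by rewrite (eq_sym l) (negPf jl) !mulr0.
Qed.

(* xi (x) eta, as a functional on U (x) V *)
Definition cotens (xi : 'Dual(U)) (eta : 'Dual(V)) : 'Dual(U \ot V) :=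
  linfun (tens_lift (fun u v => xi u * eta v : K^o)).

Lemma cotens_pure xi eta u v : cotens xi eta (pure u v) = xi u * eta v.
Proof.
rewrite lfunE /= tens_lift_pure //; split=> [w a x y|w a x y] /=.
  by rewrite linearP mulrDl -scalerAl.
by rewrite linearP mulrDr -scalerAr.
Qed.

Lemma cotens_inj (P Q : U \ot V) :
  (forall xi eta, cotens xi eta P = cotens xi eta Q) -> P = Q.
Proof.
suff cij R i j : cotens (bcov i) (bcov j) R = R i j.
  by move=> PQ; apply/matrixP => i j; rewrite -!cij PQ.
rewrite lfunE /= /tens_lift (bigD1 i) //= (bigD1 j) //=.
rewrite !big1 => [|k ki|k kj]; try (apply: big1 => l _).
all: rewrite !bcov_bvec.
- by rewrite !eqxx mulr1 !addr0 /GRing.scale /= mulr1.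
- by rewrite eq_sym (negPf ki) mul0r scaler0.
- by rewrite (eq_sym j) (negPf kj) mulr0 scaler0.
Qed.
End Tensor.

Definition tensmap (K : fieldType) (U V U' V' : vectType K)
    (f : 'Hom(U, U')) (h : 'Hom(V, V')) : 'Hom(U \ot V, U' \ot V') :=
  linfun (tens_lift (fun u v => pure (f u) (h v))).

Definition tau12 (K : fieldType) (V : vectType K) : 'End(V \ot V) :=
  linfun (tens_lift (fun u v => pure v u)).

Section PureBilinear.
Variables (K : fieldType) (U V U' V' : vectType K).

Lemma pure_bilinear : bilinear_for *:%R *:%R (@pure K U V).
Proof.
by split=> w a x y; apply/matrixP => i j; rewrite !(pureE, mxE) linearP ?mulrDl
  ?mulrDr -?scalerAl -?scalerAr.
Qed.

Lemma tensmap_pure (f : 'Hom(U, U')) (h : 'Hom(V, V')) u v :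
  tensmap f h (pure u v) = pure (f u) (h v).
Proof.
rewrite lfunE /= tens_lift_pure //; split=> w a x y; apply/matrixP => i j.
  by rewrite !(pureE, mxE) linearP /= linearP mulrDl -scalerAl.
by rewrite !(pureE, mxE) linearP /= linearP mulrDr -scalerAr.
Qed.

Lemma tau12_pure (u v : V) : tau12 V (pure u v) = pure v u.
Proof.
rewrite lfunE /= tens_lift_pure //; split=> w a x y; apply/matrixP => i j.
  by rewrite !(pureE, mxE) linearP mulrDr -scalerAr.
by rewrite !(pureE, mxE) linearP mulrDl -scalerAl.
Qed.
End PureBilinear.

Definition leibniz_algebra (K : fieldType) (V : vectType K) (br : V -> V -> V) :=
  bilinear_for *:%R *:%R br /\
  forall x y z, br x (br y z) = br (br x y) z + br y (br x z).

Section Leibniz.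
Variables (K : fieldType) (g : vectType K) (br : g -> g -> g).
Implicit Types (x y z : g) (xi eta : 'Dual(g)) (P Q : g \ot g).

Definition Lmul x : 'End(g) := linfun (br x).
Definition Rmul x : 'End(g) := linfun (br^~ x).

Definition Lstar x xi : 'Dual(g) := - (xi \o Lmul x)%VF.
Definition Rstar x xi : 'Dual(g) := - (xi \o Rmul x)%VF.

Lemma LmulE x y : bilinear_for *:%R *:%R br -> Lmul x y = br x y.
Proof.
by case=> _ bl; rewrite [LHS](linfunE (bl x)).
Qed.

Lemma RmulE x y : bilinear_for *:%R *:%R br -> Rmul x y = br y x.
Proof.
by case=> bl _; rewrite [LHS](linfunE (bl x)).
Qed.

Lemma LstarE x xi y : bilinear_for *:%R *:%R br -> Lstar x xi y = - xi (br x y).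
Proof. by move=> bl; rewrite opp_lfunE comp_lfunE LmulE. Qed.

Lemma RstarE x xi y : bilinear_for *:%R *:%R br -> Rstar x xi y = - xi (br y x).
Proof. by move=> bl; rewrite opp_lfunE comp_lfunE RmulE. Qed.

(* <sharp P xi, eta> = <P, xi (x) eta>, see sharpE *)
Definition sharp P : 'Hom('Dual(g), g) :=
  linfun (fun xi => tens_lift (fun u v => xi u *: v) P).

Lemma sharpE P xi eta : eta (sharp P xi) = cotens xi eta P.
Proof.
have sl : linear (fun xi : 'Dual(g) => tens_lift (fun u v => xi u *: v) P).
  move=> a f h; rewrite /tens_lift scaler_sumr -big_split; apply: eq_bigr => i _.
  rewrite scaler_sumr -big_split; apply: eq_bigr => j _ /=.
  rewrite add_lfunE scale_lfunE scalerDl scalerDr; congr (_ + _).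
  by rewrite !scalerA mulrCA mulrA.
rewrite /sharp linfunE // lfunE /= /tens_lift.
rewrite linear_sum; apply: eq_bigr => i _; rewrite linear_sum.
by apply: eq_bigr => j _; rewrite !linearZ; exact: mulrCA.
Qed.

Definition lfun_bracket (f h : 'Hom('Dual(g), g)) xi1 xi2 : g :=
  - f (Lstar (h xi1) xi2) + f (Lstar (h xi2) xi1) + f (Rstar (h xi2) xi1)
  + br (h xi1) (f xi2) + br (f xi1) (h xi2)
  - h (Lstar (f xi1) xi2) + h (Lstar (f xi2) xi1) + h (Rstar (f xi2) xi1).

(* The unique element of g (x) g (x) g satisfying the pairing formula tbracketE *)
Definition tbracket P Q : g \ot g \ot g :=
  \sum_i \sum_j pure (pure (bvec i) (bvec j))
                     (lfun_bracket (sharp P) (sharp Q) (bcov i) (bcov j)).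

Definition sharp_bracket (f : 'Hom('Dual(g), g)) xi eta : 'Dual(g) :=
  Lstar (f xi) eta - Lstar (f eta) xi - Rstar (f eta) xi.

(* The transpose of a bracket on the dual space, see cobracketE *)
Definition cobracket (dbr : 'Dual(g) -> 'Dual(g) -> 'Dual(g)) x : g \ot g :=
  \sum_i \sum_j dbr (bcov i) (bcov j) x *: pure (bvec i) (bvec j).

Lemma dual_bilinear_exp (W : lmodType K) (b : 'Dual(g) -> 'Dual(g) -> W) xi eta :
  bilinear_for *:%R *:%R b ->
  b xi eta = \sum_i \sum_j (xi (bvec i) * eta (bvec j)) *: b (bcov i) (bcov j).
Proof.
case=> bl bR; rewrite {1}(cov_exp xi) (linear_comb _ _ (bl eta)).
apply: eq_bigr => i _; rewrite {1}(cov_exp eta) (linear_comb _ _ (bR _)) scaler_sumr.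
by apply: eq_bigr => j _; rewrite scalerA.
Qed.

Lemma cobracketE dbr x xi eta : bilinear_for *:%R *:%R dbr ->
  cotens xi eta (cobracket dbr x) = dbr xi eta x.
Proof.
move=> bl; rewrite (dual_bilinear_exp xi eta bl) sum_lfunE linear_sum.
apply: eq_bigr => i _; rewrite sum_lfunE linear_sum; apply: eq_bigr => j _.
by rewrite scale_lfunE linearZ /= cotens_pure [LHS]mulrC.
Qed.

Lemma lfun_bracket_bilinear f h : bilinear_for *:%R *:%R br ->
  bilinear_for *:%R *:%R (lfun_bracket f h).
Proof.
move=> bl; pose bil (b : 'Dual(g) -> 'Dual(g) -> g) := bilinear_for *:%R *:%R b.
have bilD b c : bil b -> bil c -> bil (fun u v => b u v + c u v).
  move=> [b1 b2] [c1 c2]; split=> w a u v /=.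
    by rewrite (b1 w a u v) (c1 w a u v) scalerDr addrACA.
  by rewrite (b2 w a u v) (c2 w a u v) scalerDr addrACA.
have bilN b : bil b -> bil (fun u v => - b u v).
  move=> [b1 b2]; split=> w a u v /=.
    by rewrite (b1 w a u v) opprD scalerN.
  by rewrite (b2 w a u v) opprD scalerN.
have lP (V W : vectType K) (k : 'Hom(V, W)) a u v : k (a *: u + v) = a *: k u + k v.
  exact: linearP.
have bilL (k l : 'Hom('Dual(g), g)) : bil (fun u v => k (Lstar (l u) v)).
  split=> w a u v /=; rewrite -lP; congr (k _); apply/lfunP => z.
    rewrite add_lfunE scale_lfunE !LstarE // lP (bl.1 z a (l u) (l v)) lP.
    by rewrite opprD scalerN.
  by rewrite !(add_lfunE, scale_lfunE) !LstarE // !(add_lfunE, scale_lfunE)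
    opprD scalerN.
have bilR (k l : 'Hom('Dual(g), g)) : bil (fun u v => k (Rstar (l u) v)).
  split=> w a u v /=; rewrite -lP; congr (k _); apply/lfunP => z.
    rewrite add_lfunE scale_lfunE !RstarE // lP (bl.2 z a (l u) (l v)) lP.
    by rewrite opprD scalerN.
  by rewrite !(add_lfunE, scale_lfunE) !RstarE // !(add_lfunE, scale_lfunE)
    opprD scalerN.
have bilT b : bil b -> bil (fun u v => b v u) by case=> b1 b2; split.
have bilB (k l : 'Hom('Dual(g), g)) : bil (fun u v => br (k u) (l v)).
  split=> w a u v /=; rewrite lP.
    exact: (bl.1 _ a).
  exact: (bl.2 _ a).
have bilLT k l := bilT _ (bilL k l).
have bilRT k l := bilT _ (bilR k l).
apply: (bilD _ _ _ (bilRT h f)); apply: (bilD _ _ _ (bilLT h f)).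
apply: (bilD _ _ _ (bilN _ (bilL h f))); apply: (bilD _ _ _ (bilB f h)).
apply: (bilD _ _ _ (bilB h f)); apply: (bilD _ _ _ (bilRT f h)).
exact: (bilD _ _ (bilN _ (bilL f h)) (bilLT f h)).
Qed.

Lemma tbracketE P Q xi1 xi2 xi3 : bilinear_for *:%R *:%R br ->
  cotens (cotens xi1 xi2) xi3 (tbracket P Q) =
  xi3 (lfun_bracket (sharp P) (sharp Q) xi1 xi2).
Proof.
move=> bl; rewrite (dual_bilinear_exp xi1 xi2 (lfun_bracket_bilinear _ _ bl)).
rewrite !linear_sum; apply: eq_bigr => i _; rewrite !linear_sum.
by apply: eq_bigr => j _; rewrite linearZ /= !cotens_pure.
Qed.

End Leibniz.

Definition Sym2 (K : fieldType) (V : vectType K) (P : V \ot V) :=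
  tau12 V P = P.

Definition leibniz_bialgebra (K : fieldType) (g : vectType K)
    (br : g -> g -> g) (dbr : 'Dual(g) -> 'Dual(g) -> 'Dual(g)) :=
  let L := Lmul br in let R := Rmul br in
  let D := cobracket dbr in let tau := tau12 g in let Id := (\1 : 'End(g))%VF in
  [/\ leibniz_algebra br, leibniz_algebra dbr,
    forall x y, tau (tensmap (R y) Id (D x)) = tensmap (R x) Id (D y)
  & forall x y, D (br x y) =
      ((tensmap Id (R y) - tensmap (L y) Id - tensmap (R y) Id)
         \o (\1 + tau))%VF (D x)
      + (tensmap Id (L x) + tensmap (L x) Id) (D y)].

(* Main.v *)
Require Import Defs.
From mathcomp Require Import all_boot all_order all_algebra.
From mathcomp Require Import ring.

Import GRing.Theory.

Local Open Scope ring_scope.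

(* The bracket [[r, r]] pairs to twice the defect of r^# being a morphism
   from the bracket of r^# to that of g; so, 2 being invertible, the classical
   Leibniz Yang-Baxter equation makes r^# a morphism, and the Leibniz identity
   on the dual follows from the one on g.  The two compatibility conditions
   need only the symmetry of r^#: after pairing with xi (x) eta, the terms that
   contain r^# of a transposed functional cancel in pairs, and the remaining
   ones are instances of the Leibniz identity. *)

Section TensorPairing.
Context {K : fieldType}.

(** Moves operators from tensors to functionals, so that identities in [g \ot g] become scalar
    ones. *)
Lemma cotens_tensmap (U V U' V' : vectType K) (f : 'Hom(U, U'))
    (h : 'Hom(V, V')) xi eta (P : U \ot V) :
  cotens xi eta (tensmap f h P) = cotens (xi \o f)%VF (eta \o h)%VF P.
Proof.
rewrite (tens_exp P) !linear_sum; apply: eq_bigr => i _.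
rewrite !linear_sum; apply: eq_bigr => j _.
by rewrite !linearZ /= tensmap_pure !cotens_pure !comp_lfunE.
Qed.

Lemma cotens_tau12 (V : vectType K) xi eta (P : V \ot V) :
  cotens xi eta (tau12 V P) = cotens eta xi P.
Proof.
rewrite [in RHS](tens_exp P) [in LHS](tens_exp P) !linear_sum.
apply: eq_bigr => i _; rewrite !linear_sum; apply: eq_bigr => j _.
by rewrite !linearZ /= tau12_pure !cotens_pure mulrC.
Qed.

Lemma sharp_sym (V : vectType K) (r : V \ot V) (xi eta : 'Dual(V)) :
  Sym2 r -> eta (sharp r xi) = xi (sharp r eta).
Proof. by move=> rS; rewrite !sharpE -[in LHS]rS cotens_tau12. Qed.

End TensorPairing.

Section LeibnizBialgebra.
Context {K : fieldType} {g : vectType K} {br : g -> g -> g}.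
Hypothesis br_leib : leibniz_algebra br.
Implicit Types (x y z : g) (xi eta : 'Dual(g)) (f : 'Hom('Dual(g), g)).

Let br_bil : bilinear_for *:%R *:%R br := br_leib.1.

Lemma leib_linearr a x y z : br x (a *: y + z) = a *: br x y + br x z.
Proof. exact: br_bil.2. Qed.

Lemma leib_linearl a x y z : br (a *: y + z) x = a *: br y x + br z x.
Proof. exact: br_bil.1. Qed.

(** Oriented to bring iterated brackets to right-nested form, where [ring] can compare them. *)
Lemma leib_br_brl x y z : br (br x y) z = br x (br y z) - br y (br x z).
Proof. by rewrite br_leib.2 addrK. Qed.

Lemma sharp_bracketE f xi eta z :
  sharp_bracket br f xi eta z =
  - eta (br (f xi) z) + xi (br (f eta) z) + xi (br z (f eta)).
Proof.
rewrite /sharp_bracket /Lstar /Rstar !(add_lfunE, opp_lfunE, comp_lfunE).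
by rewrite !(LmulE _ _ br_bil, RmulE _ _ br_bil) !opprK.
Qed.

Lemma sharp_bracket_bilinear f :
  bilinear_for *:%R *:%R (sharp_bracket br f).
Proof.
split=> w a u v /=; apply/lfunP => z;
  rewrite [in RHS]add_lfunE [in RHS]scale_lfunE !sharp_bracketE linearP /=.
  rewrite leib_linearl linearP /= !add_lfunE !scale_lfunE /GRing.scale /=; ring.
rewrite leib_linearl leib_linearr.
rewrite !(linearP w) /= !add_lfunE !scale_lfunE /GRing.scale /=; ring.
Qed.

(** When both maps are [f], the eight terms of the bracket form four equal pairs. *)
Lemma lfun_bracket_diag f xi eta :
  lfun_bracket br f f xi eta =
  (br (f xi) (f eta) - f (sharp_bracket br f xi eta)) *+ 2.
Proof.
rewrite /lfun_bracket /sharp_bracket !(linearB f) /=.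
move: (f (Lstar _ _ _)) (f (Lstar _ _ _)) (f (Rstar _ _ _)) (br _ _).
move=> A B C D; apply: dual_inj => zeta.
rewrite linearMn !(linearB, linearD, linearN) /=; ring.
Qed.

Lemma leibniz_dual f :
  (forall xi eta, f (sharp_bracket br f xi eta) = br (f xi) (f eta)) ->
  leibniz_algebra (sharp_bracket br f).
Proof.
move=> fM; split; first exact: sharp_bracket_bilinear.
move=> xi eta zeta; apply/lfunP => z.
(* By [fM], [f] of an inner dual bracket becomes a bracket in [g]; only brackets of [z] and values
   of [f] remain. *)
rewrite [in RHS]add_lfunE !(sharp_bracketE, fM) !leib_br_brl.
rewrite !(linearB, linearD) /=; ring.
Qed.

Lemma sharp_morph {r : g \ot g} xi eta :
  2 != 0 :> K -> tbracket br r r = 0 ->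
  sharp r (sharp_bracket br (sharp r) xi eta) = br (sharp r xi) (sharp r eta).
Proof.
move=> nz2 r0; apply/esym/dual_inj => zeta; apply/eqP.
rewrite -subr_eq0 -linearB.
have := tbracketE r r xi eta zeta br_bil.
rewrite r0 linear0 lfun_bracket_diag linearMn /= -mulr_natr => /esym/eqP.
by rewrite mulf_eq0 (negPf nz2) orbF.
Qed.

Section Compatibility.
Context {f : 'Hom('Dual(g), g)}.
Hypothesis f_sym : forall xi eta, eta (f xi) = xi (f eta).
Let D := cobracket (sharp_bracket br f).

Lemma cotens_cobracket xi eta x : cotens xi eta (D x) =
  - eta (br (f xi) x) + xi (br (f eta) x) + xi (br x (f eta)).
Proof.
by rewrite cobracketE ?sharp_bracketE //; apply: sharp_bracket_bilinear.
Qed.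

Lemma cobracket_swap x y :
  tau12 g (tensmap (Rmul br y) \1%VF (D x)) = tensmap (Rmul br x) \1%VF (D y).
Proof.
apply: cotens_inj => xi eta.
rewrite cotens_tau12 !cotens_tensmap !comp_lfun1r !cotens_cobracket.
rewrite !comp_lfunE !(RmulE _ _ br_bil) !leib_br_brl !(linearB, linearD) /=.
(* Since [br (br a b) c + br (br b a) c = 0], one term survives on each side; the symmetry of [f]
   identifies the two. *)
have := f_sym (xi \o Rmul br x)%VF (eta \o Rmul br y)%VF.
rewrite !comp_lfunE !(RmulE _ _ br_bil) => ->; ring.
Qed.

(** In [D x] plus its flip the terms in [br (f _) x] cancel, leaving the pairing
    [xi (br x (f eta)) + eta (br x (f xi))]. *)
Lemma cobracket_br x y : D (br x y) =
  ((tensmap \1%VF (Rmul br y) - tensmap (Lmul br y) \1%VF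
    - tensmap (Rmul br y) \1%VF) \o (\1 + tau12 g))%VF (D x)
  + (tensmap \1%VF (Lmul br x) + tensmap (Lmul br x) \1%VF) (D y).
Proof.
apply: cotens_inj => xi eta.
have symE (u v : 'End(g)) : eta (u (f (xi \o v)%VF)) = xi (v (f (eta \o u)%VF)).
  by have := f_sym (xi \o v)%VF (eta \o u)%VF; rewrite !comp_lfunE.
(* Each relation matches a surviving term of [D x] with one of [D y], both with a transposed
   functional under [f]. *)
have := (symE (Lmul br x) (Lmul br y), symE (Lmul br x) (Rmul br y),
  symE (Rmul br y) (Lmul br x)).
rewrite !(LmulE _ _ br_bil, RmulE _ _ br_bil) => -[[E1 E2] E3].
rewrite comp_lfunE !(add_lfunE, opp_lfunE) id_lfunE !(linearD, linearN) /=.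
rewrite !cotens_tensmap !cotens_tau12 !comp_lfun1r !cotens_cobracket.
rewrite !comp_lfunE !(LmulE _ _ br_bil, RmulE _ _ br_bil).
rewrite !leib_br_brl !(linearB, linearD) /=.
rewrite E1 E2 E3; ring.
Qed.

End Compatibility.

End LeibnizBialgebra.

Theorem corollary4p12 (K : closedFieldType) (charK0 : [pchar K] =i pred0)
    (g : vectType K) (br : g -> g -> g) (r : g \ot g) :
  leibniz_algebra br -> Sym2 r -> tbracket br r r = 0 ->
  leibniz_bialgebra br (sharp_bracket br (sharp r)).
Proof.
move=> brL rS r0; have f_sym xi eta := sharp_sym _ _ xi eta rS.
have nz2 : 2 != 0 :> K by have := charK0 2; rewrite inE /= => /negbT.
split=> //; first by apply: leibniz_dual => // xi eta; apply: sharp_morph.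
- exact: cobracket_swap.
- exact: cobracket_br.
Qed.
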